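(* Let $p>7$ be a prime and let $X$ be a connected cubic vertex-transitive graph of order $12p$. If $\mathrm{Aut}(X)$ is solvable, then either $\mathrm{Aut}(X)$ has a normal Sylow $p$-subgroup, or $X\cong X(3p,2)$.
   Context: All graphs are finite, simple, undirected and connected. For an integer $n\ge 2$, $X(n,2)$ is the cubic graph of order $4n$ with vertex set $\{x_k^0,x_k^1 : k\in\mathbb{Z}_{2n}\}$ and edges $x_{2i}^r\sim x_{2i+1}^r$ for $i\in\mathbb{Z}_n$, $r\in\mathbb{Z}_2$, and $x_{2i+1}^r\sim x_{2i+2}^s$ for $i\in\mathbb{Z}_n$, $r,s\in\mathbb{Z}_2$. *)

(* Defs.v *)
From mathcomp Require Import all_boot all_order all_algebra all_fingroup all_solvable.
Set Implicit Arguments.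
Unset Strict Implicit.
Unset Printing Implicit Defensive.

Record sgraph := SGraph {
  vertex : finType;
  adj : rel vertex;
  adj_sym : symmetric adj;
  adj_irrefl : irreflexive adj }.
Coercion vertex : sgraph >-> Finite.type.

Definition nbhd (X : sgraph) (x : X) : {set X} := [set y | adj x y].

Definition cubic (X : sgraph) : Prop := forall x : X, #|nbhd x| = 3.

Definition connected (X : sgraph) : Prop :=
  forall x y : X, connect (@adj X) x y.

Definition isomorphic (X Y : sgraph) : Prop :=
  exists2 f : X -> Y,
    bijective f & forall x y : X, adj (f x) (f y) = adj x y.

Definition graph_aut (X : sgraph) : {set {perm X}} :=
  [set s : {perm X} | [forall x, forall y, adj (s x) (s y) == adj x y]].

Lemma graph_autP (X : sgraph) (s : {perm X}) :
  reflect (forall x y, adj (s x) (s y) = adj x y) (s \in graph_aut X).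
Proof.
rewrite inE; apply: (iffP 'forall_forallP) => H x y; apply/eqP.
  exact: H.
by rewrite H.
Qed.

Lemma graph_aut_group_set (X : sgraph) : group_set (graph_aut X).
Proof.
apply/group_setP; split=> [|s t /graph_autP sA /graph_autP tA].
  by apply/graph_autP=> x y; rewrite !perm1.
by apply/graph_autP=> x y; rewrite !permM tA sA.
Qed.

Canonical graph_aut_group (X : sgraph) : {group {perm X}} :=
  Group (graph_aut_group_set X).

Definition vertex_transitive (X : sgraph) : bool :=
  [transitive graph_aut X, on [set: X] | 'P].

Local Open Scope ring_scope.

(* The pair (k, r) stands for the vertex x_k^r.  The type 'Z_(2 * n) is the
   ring of integers mod 2n only when n > 0. *)
Definition Xn2_vertex (n : nat) : finType := ('Z_(2 * n) * 'Z_2)%type.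

(* Each edge x_{2i}^r ~ x_{2i+1}^r and x_{2i+1}^r ~ x_{2i+2}^s, oriented from
   left to right; the classes i mod n are represented by 0, ..., n - 1. *)
Definition Xn2_arc (n : nat) (u v : Xn2_vertex n) : bool :=
  [exists i : 'I_n, [&& u.1 == (2 * i)%N%:R, v.1 == (2 * i + 1)%N%:R
                      & u.2 == v.2]]
  || [exists i : 'I_n, (u.1 == (2 * i + 1)%N%:R) && (v.1 == (2 * i + 2)%N%:R)].

Definition Xn2_adj (n : nat) (u v : Xn2_vertex n) : bool :=
  Xn2_arc u v || Xn2_arc v u.

Lemma Xn2_adj_sym (n : nat) : symmetric (@Xn2_adj n).
Proof. by move=> u v; rewrite /Xn2_adj orbC. Qed.

Lemma Xn2_adj_irrefl (n : nat) : irreflexive (@Xn2_adj n).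
Proof.
have succ_neq (k : nat) : (k%:R == (k + 1)%N%:R :> 'Z_(2 * n)) = false.
  rewrite GRing.natrD -[X in X == _]GRing.addr0 (inj_eq (GRing.addrI _)).
  by rewrite eq_sym GRing.oner_eq0.
move=> u; rewrite /Xn2_adj orbb; apply/negbTE; rewrite negb_or.
apply/andP; split; apply/existsPn=> i; apply/negP.
  by case/and3P=> /eqP ->; rewrite succ_neq.
have -> : (2 * i + 2 = 2 * i + 1 + 1)%N by rewrite -addnA.
by case/andP=> /eqP ->; rewrite succ_neq.
Qed.

Definition Xn2 (n : nat) : sgraph :=
  SGraph (@Xn2_adj_sym n) (@Xn2_adj_irrefl n).

(* Main.v *)
Require Import Defs.
From mathcomp Require Import all_boot all_order all_algebra all_fingroup all_solvable.
From mathcomp Require Import zify.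
Set Implicit Arguments.
Unset Strict Implicit.
Unset Printing Implicit Defensive.

(* Let A be the automorphism group, P a Sylow p-subgroup and N the p'-core of A.
   Vertex stabilisers are p'-groups, so |P| = p, and P is normal in A as soon as
   it centralises N; by a fixed point count on the Sylow subgroups of N this
   happens whenever |N| divides 720.  N-orbits have size dividing 12.  If N is
   semiregular then |N| divides 12.  Otherwise every stabiliser N_u fixes exactly
   one neighbour s u of u and swaps the other two (a third possibility, N_u
   transitive on the neighbours, would leave at most two N-orbits).  Then s is an
   involution commuting with A, and u and s u lie in different N-orbits, so the
   N-orbits have size dividing 6.  If distinct vertices have distinct pairs of
   swapped neighbours, then N is faithful on each of its orbits and |N| divides
   6!.  If not, each u has a twin t u with the same pair; s and t commute because
   N-orbits are too small for the dihedral group <s, t> to be larger, and walking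
   alternately along the edges of s and the remaining edges lays X out as
   X(3p, 2). *)

Local Open Scope group_scope.

(** * Finite groups *)

Lemma dvdn_uniform_orbits (aT : finGroupType) (D : {group aT}) (rT : finType)
    (to : action D rT) (G : {group aT}) (S : {set rT}) (k : nat) :
  [acts G, on S | to] -> {in S, forall x, #|orbit to G x| = k} -> k %| #|S|.
Proof.
move=> actS orb_k.
rewrite (card_uniform_partition (n := k) _ (orbit_partition actS)).
  exact: dvdn_mull.
by move=> _ /imsetP[x Sx ->]; exact: orb_k.
Qed.

Lemma perm_orbitP (T : finType) (H : {group {perm T}}) (x y : T) :
  reflect (exists2 h, h \in H & y = h x) (y \in orbit 'P H x).
Proof. by apply: (iffP imsetP) => -[h Hh ->]; exists h. Qed.

(** An element of [G] taking [x] to [y] normalises [H], so it carries one [H]-orbit onto the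
    other. *)
Lemma card_orbit_norm_trans (T : finType) (G H : {group {perm T}}) (x y : T) :
  [transitive G, on [set: T] | 'P] -> G \subset 'N(H) ->
  #|orbit 'P H x| = #|orbit 'P H y|.
Proof.
move=> trG nHG.
have /perm_orbitP[g Gg ->] : y \in orbit 'P G x.
  by rewrite (atransP trG) ?inE.
rewrite -(card_imset (orbit 'P H x) (@perm_inj _ g)); apply: eq_card => z.
apply/imsetP/perm_orbitP => [[_ /perm_orbitP[h Hh ->] ->]|[h Hh ->]].
  exists (h ^ g); last by rewrite -permM conjgC permM.
  by rewrite memJ_norm // (subsetP nHG).
exists ((h ^ g^-1) x); last by rewrite -!permM conjgE invgK !mulgA mulgKV.
by apply/perm_orbitP; exists (h ^ g^-1); rewrite // memJ_norm ?groupV // (subsetP nHG).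
Qed.

Lemma dvdn_orbit_norm_trans (T : finType) (G H : {group {perm T}}) (x : T) :
  [transitive G, on [set: T] | 'P] -> G \subset 'N(H) ->
  #|orbit 'P H x| %| #|T|.
Proof.
move=> trG nHG; rewrite -cardsT.
apply: (dvdn_uniform_orbits (to := 'P%act) (G := H)); last first.
  by move=> y _; apply: card_orbit_norm_trans trG nHG.
by apply/subsetP=> h _; rewrite !inE; apply/subsetP=> y _; rewrite !inE.
Qed.

(** The prime [p] divides [q - c]. A finite check shows that the nonzero differences between such a
    [q] and its divisors have prime factors at most 7; the factor 7 does occur, in 8 - 1 and 16 - 2,
    whence the bound on [p]. *)
Lemma small_dvdn_eq_mod (p q c : nat) :
    prime p -> 7 < p -> c %| q -> q = c %[mod p] ->
    [|| q %| 16, q %| 9 | q %| 5] ->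
  q = c.
Proof.
move=> p_pr p_gt7 c_q eq_qc small_q.
have q_gt0 : 0 < q by case: q small_q {c_q eq_qc}.
have q_le16 : q <= 16.
  by case/or3P: small_q => /dvdn_leq le_q; apply: leq_trans (le_q isT) _.
have c_le_q : c <= q by exact: dvdn_leq q_gt0 c_q.
have p_dvd : p %| q - c.
  rewrite -(eqn_mod_dvd p c_le_q).
  exact/eqP.
have /allP/(_ q) : all (fun m => all (fun d => (d == m) ||
      ((0 < m - d) && all (fun r => r <= 7) (primes (m - d)))) (divisors m))
    [seq m <- iota 1 16 | [|| m %| 16, m %| 9 | m %| 5]].
  by clear; vm_compute.
rewrite mem_filter small_q mem_iota q_gt0 add1n ltnS q_le16.
move/(_ isT)/allP/(_ c); rewrite -dvdn_divisors // => /(_ c_q).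
case/orP=> [/eqP // | /andP[d_gt0 /allP/(_ p)]].
by rewrite mem_primes p_pr d_gt0 p_dvd leqNgt p_gt7 => /(_ isT).
Qed.

(** The fixed points of [P] acting on [Q] by conjugation form a subgroup, so their number divides
    the order of [Q] and is congruent to it mod [p]. *)
Lemma pgroup_cent_small (gT : finGroupType) (p : nat) (P Q : {group gT}) :
    prime p -> 7 < p -> p.-group P -> P \subset 'N(Q) ->
    [|| #|Q| %| 16, #|Q| %| 9 | #|Q| %| 5] ->
  P \subset 'C(Q).
Proof.
move=> p_pr p_gt7 pP nQP smallQ.
have /(pgroup_fix_mod pP) modQ : [acts P, on Q | 'J] by rewrite astabsJ.
rewrite afixJ in modQ.
rewrite centsC -[gval Q]setIid.
have := small_dvdn_eq_mod p_pr p_gt7 (cardSg (subsetIl Q 'C(P))) modQ smallQ.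
by move=> eqQ; rewrite setIid; apply/setIidPl/eqP; rewrite eqEcard subsetIl -eqQ /=.
Qed.

(** Coprime action gives, for each prime [q], a Sylow [q]-subgroup of [N] normalised by [P]. As 720
    = 2^4 3^2 5, the fixed point count applies to it, so the centraliser of [P] in [N] has the full
    [q]-part. *)
Lemma pgroup_cent_dvdn720 (gT : finGroupType) (p : nat) (P N : {group gT}) :
    prime p -> 7 < p -> p.-group P -> P \subset 'N(N) -> #|N| %| 720 ->
  P \subset 'C(N).
Proof.
move=> p_pr p_gt7 pP nNP N720.
rewrite centsC; apply/setIidPl/eqP; rewrite eqEcard subsetIl /=.
apply: dvdn_leq => //; apply/dvdn_partP => // q.
rewrite mem_primes => /and3P[q_pr _ q_dvd].
have coNP : coprime #|N| #|P|.
  rewrite coprime_sym; have [n ->] := p_natP pP; rewrite coprimeXl // prime_coprime //.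
  apply: contraL p_gt7 => /dvdn_trans/(_ N720) p720; rewrite -leqNgt.
  have : p \in primes 720 by rewrite mem_primes p_pr.
  suff /allP : all (fun r => r <= 7) (primes 720) by apply.
  by clear; vm_compute.
have [Q sylQ nQP] := sol_coprime_Sylow_exists q (pgroup_sol pP) nNP coNP.
rewrite -(card_Hall sylQ) cardSg // subsetI (pHall_sub sylQ) centsC.
apply: pgroup_cent_small p_pr p_gt7 pP nQP _.
rewrite (card_Hall sylQ).
have : q \in primes 720 by rewrite mem_primes q_pr (dvdn_trans q_dvd).
have -> : primes 720 = [:: 2; 3; 5] by clear; vm_compute.
have := partn_dvd q (isT : 0 < 720) N720; rewrite (p_part q 720).
rewrite !inE => Nq /or3P[] /eqP def_q; rewrite def_q in Nq *.
- by rewrite (_ : logn 2 720 = 4) in Nq; [rewrite Nq | clear; vm_compute].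
- by rewrite (_ : logn 3 720 = 2%N) in Nq; [rewrite Nq orbT | clear; vm_compute].
- by rewrite (_ : logn 5 720 = 1%N) in Nq; [rewrite Nq !orbT | clear; vm_compute].
Qed.

(** Modulo the [p']-core [N], solvability makes the Fitting subgroup a nontrivial [p]-group, hence
    the image of [P]. So [N <*> P] is normal in [G]; [P] is a normal Sylow subgroup of it, hence
    characteristic in it. *)
Lemma Sylow_normal_of_cent_pcore (gT : finGroupType) (p : nat)
    (G P : {group gT}) :
    prime p -> solvable G -> p.-Sylow(G) P -> #|P| = p ->
    P \subset 'C('O_p^'(G)) ->
  P <| G.
Proof.
have [N defN] : {N : {group gT} | N :=: 'O_p^'(G)} by exists 'O_p^'(G)%G.
move=> p_pr solG sylP oP; rewrite -defN => cNP.
have sPG := pHall_sub sylP.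
have nsNG : N <| G by rewrite defN pcore_normal.
have nNG := normal_norm nsNG.
have p'N : p^'.-group N by rewrite defN pcore_pgroup.
have tiNP : N :&: P = 1.
  by rewrite setIC (coprime_TIg (pnat_coprime (pHall_pgroup sylP) p'N)).
have nsPN : P / N <| G / N.
  have sylPN := quotient_pHall (subset_trans sPG nNG) sylP.
  suff <- : 'O_p(G / N) = P / N by exact: pcore_normal.
  apply/eqP; rewrite eqEcard (pcore_sub_Hall sylPN) /=.
  apply: leq_trans (leq_quotient N P) _; rewrite oP.
  have [trGN | ntGN] := eqVneq (G / N) 1.
    have := prime_gt1 p_pr; rewrite ltnNge -oP => /negP[].
    rewrite (_ : gval P = 1) ?cards1 //; apply/trivgP; rewrite -tiNP subsetI subxx.
    by rewrite (subset_trans sPG) // -quotient_sub1 // trGN.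
  have ntO : 'O_p(G / N) != 1.
    rewrite -Fitting_eq_pcore ?defN ?trivg_pcore_quotient //.
    by rewrite -defN trivg_Fitting // quotient_sol.
  have [_ p_dvd _] := pgroup_pdiv (pcore_pgroup p (G / N)) ntO.
  exact: dvdn_leq.
have nsNPG : N <*> P <| G.
  rewrite joingC norm_joinEl ?(subset_trans sPG) //.
  rewrite normC ?(subset_trans sPG) // -quotientK ?(subset_trans sPG) //.
  by rewrite -(quotientGK nsNG) cosetpre_normal.
apply: (char_normal_trans _ (nsNPG)).
have nsP : P <| N <*> P.
  rewrite /normal joing_subr join_subG normG andbT centsC in cNP *.
  by rewrite cents_norm.
have sylPN : p.-Sylow(N <*> P) P.
  exact: pHall_subl (joing_subr _ _) (normal_sub nsNPG) sylP.
by have := pcore_char p (N <*> P); rewrite (normal_Hall_pcore sylPN nsP).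
Qed.

Local Close Scope group_scope.

(** * Recognising X(n, 2) *)

Lemma connected_ind (X : sgraph) (Q : X -> Prop) (x : X) :
    connected X -> Q x -> (forall y z, adj y z -> Q y -> Q z) ->
  forall z, Q z.
Proof.
move=> connX Qx Qadj z; have /connectP[e] := connX x z.
elim: e x Qx => [|y e IHe] x Qx /=; first by move=> _ ->.
by case/andP=> xy /IHe; apply; apply: Qadj xy Qx.
Qed.

(** With representatives below 2n, only the arcs out of the odd class 2n - 1 wrap around. *)
Lemma Xn2_arcE (n : nat) (u v : Xn2_vertex n) : 0 < n ->
  Xn2_arc u v = if odd u.1 then v.1 == u.1.+1 %% (2 * n) :> nat
                else (v.1 == u.1.+1 :> nat) && (u.2 == v.2).
Proof.
move=> n_gt0; have n2_gt1 : 1 < 2 * n by lia.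
have lt2n (a : 'Z_(2 * n)) : a < 2 * n by rewrite -[X in _ < X]Zp_cast.
have ltu := lt2n u.1; have ltv := lt2n v.1.
have valE (a : 'Z_(2 * n)) k : (a == k%:R)%R = (a == k %% (2 * n) :> nat).
  by rewrite -val_eqE /= val_Zp_nat.
apply/orP/idP => [[/existsP[i] | /existsP[i]]|]; rewrite ?valE.
- have lti := ltn_ord i.
  case/and3P=> /eqP-> /eqP-> ->; rewrite !modn_small; try lia.
  by rewrite mul2n odd_double addn1 eqxx.
- have lti := ltn_ord i.
  case/andP=> /eqP-> /eqP->; rewrite (modn_small (m := 2 * i + 1)); last by lia.
  by rewrite addn1 mul2n /= odd_double /= addn2.
have lthalf : u.1./2 < n by lia.
case: ifP => odd_u.
  move=> /eqP def_v; right; apply/existsP; exists (Ordinal lthalf).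
  rewrite !valE def_v /= modn_small; last by lia.
  rewrite (_ : 2 * u.1./2 + 2 = u.1.+1); last by lia.
  rewrite eqxx andbT; lia.
case/andP=> /eqP def_v eq_uv; left; apply/existsP; exists (Ordinal lthalf).
rewrite !valE def_v eq_uv /= !modn_small; lia.
Qed.

(* [s u] and [t u] abstract the partner of x_k^r along the edge
   x_{2i}^r ~ x_{2i+1}^r and its twin x_k^{1-r}; by [rest] the other two
   neighbours of any vertex form a pair {w, t w}. *)
Section SplitCycle.

Variables (X : sgraph) (s t : X -> X).
Hypotheses (sK : involutive s) (tK : involutive t).
Hypothesis stC : forall u, s (t u) = t (s u).
Hypothesis adj_s : forall u, adj u (s u).
Hypothesis t_neq : forall u, t u != u.
Hypothesis s_neq_t : forall u, s u != t u.
Hypothesis rest : forall u, exists w, forall v,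
  adj u v && (v != s u) = (v == w) || (v == t w).

(** Its classes are to become the pairs {x_k^0, x_k^1}. *)
Let sim (a b : X) := (b == a) || (b == t a).

Let simxx a : sim a a. Proof. by rewrite /sim eqxx. Qed.
Let sim_sym a b : sim a b -> sim b a.
Proof. by case/orP=> /eqP->; rewrite /sim ?tK eqxx ?orbT. Qed.
Let sim_trans b a c : sim a b -> sim b c -> sim a c.
Proof. by case/orP=> /eqP-> /orP[]/eqP->; rewrite /sim ?tK eqxx ?orbT. Qed.

(** Only the class of [g u] under [sim] matters; by [rest] the default [u] is never taken. *)
Let g (u : X) := odflt u [pick w | adj u w && (w != s u)].

Let gP u v : adj u v && (v != s u) = sim (g u) v.
Proof.
have [w wP] := rest u; rewrite /g; case: pickP => [w'|/(_ w)] /=; last first.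
  by rewrite wP eqxx.
by rewrite !wP => /orP[]/eqP-> //; rewrite /sim tK orbC.
Qed.

Let gC u v : sim (g u) v = sim (g v) u.
Proof. by rewrite -!gP adj_sym -(inj_eq (can_inj sK)) sK eq_sym. Qed.

Let sim_s a b : sim a b -> sim (s a) (s b).
Proof. by case/orP=> /eqP->; rewrite /sim ?stC eqxx ?orbT. Qed.

Let sim_g a b : sim a b -> sim (g a) (g b).
Proof.
move=> ab; rewrite gC; apply: sim_trans (sim_sym ab).
by rewrite -gC.
Qed.

Let gg a : sim a (g (g a)).
Proof. by apply: sim_sym; rewrite -gC. Qed.

(** The walk leaves even positions along [s] and odd ones along [g], as the edges of X(n, 2) do. *)
Let step (odd : bool) := if odd then g else s.

Let sim_step o a b : sim a b -> sim (step o a) (step o b).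
Proof. by case: o; [apply: sim_g | apply: sim_s]. Qed.

Let stepK o a : sim a (step o (step o a)).
Proof. by case: o => /=; [apply: gg | rewrite sK]. Qed.

Let step_fix o a : ~~ sim a (step o a).
Proof.
apply/negP; case: o => /= [/sim_sym | ].
  by rewrite -gP adj_irrefl.
rewrite /sim (negPf (s_neq_t a)) orbF => /eqP sa.
by have := adj_s a; rewrite sa adj_irrefl.
Qed.

(** * The alternating walk and its period *)

Variable x0 : X.
Let x := fix x k := if k is k'.+1 then step (odd k') (x k') else x0.

Let xS k : x k.+1 = step (odd k) (x k). Proof. by []. Qed.

Let back k : sim (x k) (step (odd k) (x k.+1)).
Proof. exact: stepK. Qed.

(* Vertices at odd distance along the walk are never twins: the two ends could
   be moved towards each other until they are consecutive. *)
Let sim_x_parity i d : ~~ sim (x i) (x (i + d.*2.+1)).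
Proof.
elim: d i => [|d IHd] i; first by rewrite addn1 xS step_fix.
apply: contra (IHd i.+1) => /(@sim_step (odd i)) sim_i.
rewrite xS; apply: sim_trans sim_i _; apply: sim_sym.
have -> : i + d.+1.*2.+1 = (i.+1 + d.*2.+1).+1 by lia.
have -> : odd i = odd (i.+1 + d.*2.+1) by lia.
exact: back.
Qed.

(** The two indices have the same parity, so the same kind of step is undone at both ends. *)
Let sim_x_shift i d : sim (x i) (x (i + d.*2)) -> sim (x 0) (x d.*2).
Proof.
elim: i => // i IHi sim_i; apply: IHi.
apply: sim_trans (back i) _.
have {1}-> : odd i = odd (i + d.*2) by lia.
by apply: sim_sym; apply: sim_trans (back _) _; apply/sim_step/sim_sym.
Qed.

(** The walk revisits a vertex by the pigeonhole principle; parity excludes an odd gap, and an even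
    gap can be shifted back to the start. *)
Let period : exists d, (0 < d) && sim (x 0) (x d.*2).
Proof.
have [i [j [lt_ij sim_ij]]] : exists i, exists j, i < j /\ x i = x j.
  have /injectivePn[i [j ne_ij eq_x]] : ~~ injectiveb (fun i : 'I_#|X|.+1 => x i).
    apply/negP=> /injectiveP/leq_card; rewrite card_ord.
    by rewrite ltnn.
  case: (ltngtP i j) => [lt_ij | lt_ji | /val_inj eq_ij].
  - by exists i, j.
  - by exists j, i.
  - by rewrite eq_ij eqxx in ne_ij.
have [odd_ij | even_ij] := boolP (odd (j - i)).
  have := sim_x_parity i (j - i)./2.
  have -> : i + (j - i)./2.*2.+1 = j by lia.
  by rewrite -sim_ij simxx.
exists (j - i)./2; apply/andP; split; first by lia.
apply: (@sim_x_shift i); have -> : i + (j - i)./2.*2 = j by lia.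
by rewrite -sim_ij.
Qed.

(** The walk need only close up to twins: [x m.*2] may be [x0] or [t x0]. *)
Let m := ex_minn period.
Let m_gt0 : 0 < m. Proof. by rewrite /m; case: ex_minnP => ? /andP[]. Qed.
Let sim_m : sim (x 0) (x m.*2).
Proof. by rewrite /m; case: ex_minnP => ? /andP[]. Qed.
Let m_min d : 0 < d -> sim (x 0) (x d.*2) -> m <= d.
Proof.
by move=> d0 simd; rewrite /m; case: ex_minnP => ? _; apply; rewrite d0.
Qed.

Let x_inj i j : i < m.*2 -> j < m.*2 -> sim (x i) (x j) -> i = j.
Proof.
wlog: i j / i <= j => [IH lti ltj sim_ij | le_ij lti ltj sim_ij].
  case: (leqP i j) => [le_ij | /ltnW le_ji]; first exact: IH.
  by apply/esym/IH => //; apply: sim_sym.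
have [odd_ij | even_ij] := boolP (odd (j - i)).
  have := sim_x_parity i (j - i)./2.
  by have -> : i + (j - i)./2.*2.+1 = j by [lia]; rewrite sim_ij.
have [|d_gt0] := posnP (j - i)./2; first by lia.
have := @m_min _ d_gt0 (@sim_x_shift i _ _).
have -> : i + (j - i)./2.*2 = j by lia.
move/(_ sim_ij); lia.
Qed.

Let s_even k : ~~ odd k -> s (x k) = x k.+1.
Proof. by move=> even_k; rewrite xS (negPf even_k). Qed.

Let s_odd k : odd k -> s (x k) = x k.-1.
Proof. by case: k => // k /= even_k; rewrite (negPf even_k) sK. Qed.

(** The cyclic predecessor modulo 2m, whence the value at 0. *)
Let prev k := if k is k'.+1 then k' else m.*2.-1.

Let g_odd k : odd k -> k < m.*2 -> sim (x (k.+1 %% m.*2)) (g (x k)).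
Proof.
move=> odd_k ltk; have -> : g (x k) = x k.+1 by rewrite xS odd_k.
have [lt | ge] := ltnP k.+1 m.*2; first by rewrite modn_small.
by have -> : k.+1 = m.*2 by [lia]; rewrite modnn.
Qed.

Let g_even k : ~~ odd k -> k < m.*2 -> sim (x (prev k)) (g (x k)).
Proof.
case: k => [_ _ | k /= odd_k _]; last first.
  by have := back k; rewrite xS; rewrite negbK in odd_k; rewrite odd_k.
(* At 0, the [g]-edge is the last step of the walk, which leaves the odd position [m.*2.-1] and ends
   in the class of [x 0]. *)
apply: sim_sym; rewrite /prev; apply: sim_trans (sim_g sim_m) _.
apply: sim_sym; have := back m.*2.-1.
by rewrite prednK; last lia; rewrite (_ : odd _ = true); last lia.
Qed.

Let x_surj : connected X -> forall v, exists2 k, k < m.*2 & sim (x k) v.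
Proof.
move=> connX; apply: (connected_ind (x := x0) connX).
  by exists 0; rewrite ?simxx; first lia.
move=> y z adj_yz [k ltk sim_y].
have [z_s | z_s] := eqVneq z (s y).
  have sim_z : sim (s (x k)) z by rewrite z_s; apply: sim_s.
  have [odd_k | even_k] := boolP (odd k).
    by exists k.-1; [lia | rewrite -s_odd].
  by exists k.+1; [lia | rewrite -s_even].
have sim_z : sim (g (x k)) z.
  by apply: sim_trans (sim_g sim_y) _; rewrite -gP adj_yz.
have [odd_k | even_k] := boolP (odd k).
  exists (k.+1 %% m.*2); first by rewrite ltn_mod; lia.
  exact: sim_trans (g_odd _ _) sim_z.
exists (prev k); first by rewrite /prev; case: (k) ltk; lia.
exact: sim_trans (g_even _ _) sim_z.
Qed.

(** * Coordinates and the isomorphism *)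

Let y (k : nat) (b : bool) := if b then t (x k) else x k.

Let sim_y k b : sim (x k) (y k b).
Proof. by rewrite /sim /y; case: b; rewrite eqxx ?orbT. Qed.

Let y_inj k k' b b' : k < m.*2 -> k' < m.*2 -> y k b = y k' b' -> k = k' /\ b = b'.
Proof.
move=> ltk ltk' eq_y.
have eq_k : k = k'.
  apply: x_inj => //; apply: sim_trans (sim_y k b) _; rewrite eq_y.
  exact/sim_sym/sim_y.
split=> //; move: eq_y; rewrite -eq_k /y.
by case: b; case: b' => // /eqP; rewrite ?(negPf (t_neq _)) // eq_sym (negPf (t_neq _)).
Qed.

Let sim_yP k v : sim (x k) v -> exists b, v = y k b.
Proof. by case/orP=> /eqP->; [exists false | exists true]. Qed.

(** By connectedness the 2m classes, of two vertices each, exhaust [X]; thus 4m = 4n. *)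
Let period_eq (n : nat) : connected X -> #|X| = 4 * n -> m = n.
Proof.
move=> connX cardX; pose F (kb : 'I_m.*2 * bool) := y kb.1 kb.2.
have injF : injective F.
  move=> [k b] [k' b'] /y_inj[] //= /val_inj -> -> //.
have surjF : [set: X] \subset F @: setT.
  apply/subsetP=> v _; have [k ltk /sim_yP[b ->]] := x_surj connX v.
  by apply/imsetP; exists (Ordinal ltk, b).
have := leq_card F injF; have := leq_trans (subset_leq_card surjF) (leq_imset_card _ _).
rewrite !cardsT card_prod card_ord card_bool cardX; lia.
Qed.

Let adj_y k b v : adj (y k b) v = (v == s (y k b)) || sim (g (x k)) v.
Proof.
have [-> | v_s] /= := eqVneq v (s (y k b)); first exact: adj_s.
rewrite -[adj _ _]andbT -v_s gP.
have sim_gy : sim (g (x k)) (g (y k b)) by apply/sim_g/sim_y.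
apply/idP/idP; first exact: sim_trans.
by apply: sim_trans; apply: sim_sym.
Qed.

Let s_y k b : s (y k b) = y (if odd k then k.-1 else k.+1) b.
Proof.
have -> : s (y k b) = if b then t (s (x k)) else s (x k).
  by rewrite /y; case: b; rewrite ?stC.
have [odd_k | even_k] := boolP (odd k); first by rewrite (s_odd odd_k).
by rewrite (s_even even_k).
Qed.

Lemma split_cycle_isomorphic_Xn2 (n : nat) :
  connected X -> #|X| = 4 * n -> isomorphic X (Xn2 n).
Proof.
move=> connX cardX; have def_m := period_eq connX cardX.
have n_gt0 : 0 < n by rewrite -def_m.
have n2_gt1 : 1 < 2 * n by lia.
have lt_u (u : Xn2 n) : u.1 < m.*2 by rewrite def_m -mul2n -[X in _ < X]Zp_cast.
have m2 : m.*2 = 2 * n by rewrite def_m mul2n.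
have g_odd2n k : odd k -> k < m.*2 -> sim (x (k.+1 %% (2 * n))) (g (x k)).
  by rewrite -m2; apply: g_odd.
have prev_succ k : ~~ odd k -> k < m.*2 ->
    odd (prev k) && (k == (prev k).+1 %% (2 * n)).
  rewrite -m2; case: k => [_ _ | k] /=; last first.
    by rewrite negbK => -> /modn_small->; rewrite eqxx.
  by rewrite prednK ?modnn ?eqxx //; lia.
pose F (u : Xn2 n) := y u.1 (u.2 != 0%R).
have eqZ2 (a b : 'Z_2) : (a != 0%R) = (b != 0%R) -> a = b.
  by case: a b => [[|[|a]] lta] [[|[|b]] ltb] // _; apply: val_inj.
have injF : injective F.
  move=> u v eqF; have [] := y_inj (lt_u u) (lt_u v) eqF.
  by case: u v {eqF} => [k b] [k' b'] /= /val_inj -> /eqZ2 ->.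
have arcF u v : Xn2_arc u v -> adj (F u) (F v).
  rewrite Xn2_arcE // adj_y s_y; case: ifP => odd_u.
    move/eqP=> def_v; apply/orP; right.
    by apply: sim_trans (sim_y v.1 _); rewrite def_v; apply/sim_sym/g_odd2n.
  by case/andP=> /eqP def_v /eqP eq_uv; rewrite /F def_v eq_uv eqxx.
(* An edge along [s] keeps the second coordinate, and the other edges reach a whole class; the
   parity of [u.1] decides which end is the tail of the arc. *)
have adjF u v : adj (F u) (F v) = Xn2_adj u v.
  apply/idP/orP => [|[/arcF // | /arcF]]; last by rewrite adj_sym.
  rewrite adj_y s_y => /orP[/eqP/y_inj[] | sim_v].
  - exact: lt_u.
  - by have := lt_u u; case: ifP; lia.
  - move=> def_v /eqZ2 eq_uv; rewrite !Xn2_arcE // eq_uv eqxx !andbT def_v.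
    have [odd_u | even_u] := boolP (odd u.1); [right | by left; rewrite eqxx].
    by move: odd_u; case: (nat_of_ord u.1) => //= k; rewrite eqxx => /negPf->.
  have [odd_u | even_u] := boolP (odd u.1); [left | right].
    rewrite Xn2_arcE // odd_u; apply/eqP.
    have sim_uv := sim_trans (g_odd2n _ odd_u (lt_u u))
      (sim_trans sim_v (sim_sym (sim_y v.1 _))).
    apply: esym; apply: x_inj (lt_u v) sim_uv.
    by rewrite m2 ltn_mod; lia.
  have sim_uv := sim_trans (g_even even_u (lt_u u))
      (sim_trans sim_v (sim_sym (sim_y v.1 _))).
  have def_v : prev u.1 = v.1.
    apply: x_inj (lt_u v) sim_uv.
    by have := lt_u u; rewrite /prev; case: (nat_of_ord u.1); lia.
  have /andP[odd_prev eq_u] := prev_succ _ even_u (lt_u u).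
  by rewrite Xn2_arcE // -def_v odd_prev.
have bijF : bijective F.
  apply: inj_card_bij => //; rewrite cardX card_prod !card_ord Zp_cast //; lia.
have [f FK fK] := bijF; exists f; first by exists F.
by move=> a b; rewrite -{2}(fK a) -{2}(fK b) adjF.
Qed.

End SplitCycle.

Local Open Scope group_scope.

(** * Normal subgroups of the automorphism group of a cubic graph *)

Lemma card3_third (T : finType) (S : {set T}) (x y : T) :
    #|S| = 3 -> x \in S -> y \in S -> x != y ->
  exists z, [/\ z \in S, z != x, z != y &
    forall v, v \in S -> v != x -> v != y -> v = z].
Proof.
move=> S3 Sx Sy neq_xy.
have /eqP/cards1P[z defz] : #|S :\ x :\ y| = 1%N.
  have := cardsD1 y (S :\ x); have := cardsD1 x S.
  by rewrite !inE S3 Sx Sy eq_sym neq_xy /=; lia.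
have /setP/(_ z) := defz; rewrite !inE eqxx => /and3P[zy zx Sz].
exists z; split=> // v Sv vx vy; apply/set1P.
by rewrite -defz !inE vx vy.
Qed.

Section NormalSubgroup.

Variable X : sgraph.
Hypotheses (connX : connected X) (cubicX : cubic X).
Hypothesis trA : vertex_transitive X.
Variable N : {group {perm X}}.
Hypothesis nsNA : N <| graph_aut X.

Let A := graph_aut_group X.
Let sNA : N \subset A := normal_sub nsNA.
Let O (u : X) := orbit 'P N u.

Let adjA a x y : a \in A -> adj (a x) (a y) = adj x y.
Proof. by move/graph_autP. Qed.

Let adjN n x y : n \in N -> adj (n x) (n y) = adj x y.
Proof. by move/(subsetP sNA)/adjA. Qed.

Let transA x y : exists2 a, a \in A & y = a x.
Proof. by apply/perm_orbitP; rewrite (atransP trA) ?inE. Qed.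

Let normN n a : n \in N -> a \in A ->
  exists2 m, m \in N & forall x, n (a x) = a (m x).
Proof.
move=> Nn Aa; exists (n ^ a^-1).
  by rewrite memJ_norm // groupV (subsetP (normal_norm nsNA)).
by move=> x; rewrite -!permM conjgE invgK !mulgA mulgKV.
Qed.

Let O_refl u : u \in O u. Proof. exact: orbit_refl. Qed.
Let O_sym u v : (u \in O v) = (v \in O u). Proof. exact: orbit_sym. Qed.
Let O_trans v u w : u \in O v -> v \in O w -> u \in O w.
Proof. exact: orbit_trans. Qed.
Let O_N u n : n \in N -> n u \in O u. Proof. exact: mem_orbit. Qed.

Let normA n a : n \in N -> a \in A ->
  exists2 m, m \in N & forall x, a (n x) = m (a x).
Proof.
move=> Nn Aa; exists (n ^ a).
  by rewrite memJ_norm // (subsetP (normal_norm nsNA)).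
by move=> x; rewrite -!permM -conjgC.
Qed.

Let O_A u v a : a \in A -> v \in O u -> a v \in O (a u).
Proof.
by move=> Aa /perm_orbitP[n Nn ->]; have [m Nm ->] := normA Nn Aa; apply: O_N.
Qed.

Let card_O u v : #|O u| = #|O v|.
Proof. exact: card_orbit_norm_trans trA (normal_norm nsNA). Qed.

Let St u := 'C_N[u | 'P].

Let StP u n : reflect (n \in N /\ n u = u) (n \in St u).
Proof.
rewrite inE; apply: (iffP andP) => -[Nn]; first by move/astab1P.
by move=> nu; split=> //; apply/astab1P.
Qed.

Let St_A u v a : a \in A -> St u \subset St v -> St (a u) \subset St (a v).
Proof.
move=> Aa /subsetP sSt; apply/subsetP=> n /StP[Nn nau]; apply/StP; split=> //.
have [m Nm mE] := normN Nn Aa; rewrite mE in nau; rewrite mE.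
have /sSt/StP[_ ->] // : m \in St u.
by apply/StP; split=> //; apply: perm_inj nau.
Qed.

(** All [N]-orbits have the same size, so all stabilisers have the same order. *)
Let St_eq u v : St u \subset St v -> St u = St v.
Proof.
move=> sSt; apply/eqP; rewrite eqEcard sSt /=.
suff -> : #|St v| = #|St u| by [].
have O_gt0 : 0 < #|O u| by apply/card_gt0P; exists u.
apply/eqP; rewrite -(eqn_pmul2l O_gt0); apply/eqP.
apply: etrans (esym (card_orbit_stab 'P N u)).
exact: etrans (congr1 (muln^~ _) (card_O u v)) (card_orbit_stab 'P N v).
Qed.

(** * Action of a nontrivial stabiliser on neighbours *)

Variables (u0 : X) (n0 : {perm X}).
Hypotheses (Nn0 : n0 \in N) (n0u0 : n0 u0 = u0) (ntn0 : n0 != 1).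

(** If [St u] fixed all neighbours of [u], transitivity would give this at every vertex, and by
    connectedness [n0] would fix all of [X]. *)
Let St_nbhd u : exists n v, [/\ n \in St u, adj u v & n v != v].
Proof.
suff /existsP[n /existsP[v /and3P[]]] :
  [exists n, exists v, [&& n \in St u, adj u v & n v != v]] by exists n, v.
apply: contraR ntn0 => /existsPn no_nv.
have sSt_u v : adj u v -> St u \subset St v.
  move=> uv; apply/subsetP=> n Stn; have /StP[Nn _] := Stn.
  apply/StP; split=> //; apply/eqP.
  by have /existsPn/(_ v) := no_nv n; rewrite Stn uv /= negbK.
have sSt x v : adj x v -> St x \subset St v.
  have [a Aa ->] := transA u x.
  have -> : v = a (a^-1 v) by rewrite permKV.
  by rewrite adjA // => /sSt_u; apply: St_A.
apply/eqP/permP=> x; rewrite perm1.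
suff /subsetP/(_ n0) : St u0 \subset St x.
  by move=> Stx; have /StP[] : n0 \in St x by apply/Stx/StP.
apply: (connected_ind (Q := fun x => St u0 \subset St x) connX (subxx _)).
by move=> y z /sSt sStz sSty; apply: subset_trans sSty sStz.
Qed.

Hypothesis orb_small : forall u, 2 * #|O u| < #|X|.

Let not_covered u w :
    (forall x y, x \in O u :|: O w -> adj x y -> y \in O u :|: O w) ->
  False.
Proof.
move=> closed; have allX x : x \in O u :|: O w.
  apply: (connected_ind (Q := fun x => x \in O u :|: O w) (x := u) connX).
    by rewrite inE O_refl.
  by move=> y z yz Oy; apply: closed Oy yz.
have := orb_small u; rewrite ltnNge => /negP[].
have <- : #|O u :|: O w| = #|X| by apply: eq_card => x; rewrite allX.
by rewrite (leq_trans (leq_card_setU _ _)) // (card_O w u); lia.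
Qed.

(* Otherwise two N-orbits would cover X. *)
Let nbhd_orbits u : exists v v', [/\ adj u v, adj u v' & v' \notin O v].
Proof.
suff /existsP[v /existsP[v' /and3P[]]] :
  [exists v, exists v', [&& adj u v, adj u v' & v' \notin O v]] by exists v, v'.
rewrite -[[exists _, _]]negbK; apply/negP=> /existsPn no_vv'.
have one_u v v' : adj u v -> adj u v' -> v' \in O v.
  move=> uv uv'; have /existsPn/(_ v') := no_vv' v.
  by rewrite uv uv' negbK.
have one x v v' : adj x v -> adj x v' -> v' \in O v.
  have [a Aa ->] := transA u x.
  have -> : v = a (a^-1 v) by rewrite permKV.
  have -> : v' = a (a^-1 v') by rewrite permKV.
  by rewrite !adjA // => uv /(one_u _ _ uv); apply: O_A.
have [_ [w [_ uw _]]] := St_nbhd u.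
have cl a b x y : adj a b -> x \in O a -> adj x y -> y \in O b.
  move=> ab /perm_orbitP[n Nn ->] xy.
  by apply: O_trans (one _ _ _ _ xy) (O_N b Nn); rewrite adjN.
apply: (@not_covered u w) => x y; rewrite !inE => /orP[] Ox xy.
  by rewrite (cl u w x) ?orbT.
by rewrite (cl w u x) // adj_sym.
Qed.

Let nbhdE (u v : X) : (v \in nbhd u) = adj u v. Proof. by rewrite inE. Qed.

(** Some [n] in [St u] moves a neighbour [w]; let [z] be the neighbour other than [w] and [n w]. The
    neighbours of [u] do not all share an orbit, so [z] lies outside the orbit of [w] and all of
    [St u] fixes it. *)
Let local_structure (u : X) : exists (z w w' : X) (n : {perm X}),
  [/\ adj u z, St u \subset St z, n \in St u, n w = w' & w != w'] /\
  [/\ adj u w, adj u w', z != w, z != w' &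
      forall v, adj u v -> v != z -> (v == w) || (v == w')].
Proof.
have [n [w [Stn uw nw]]] := St_nbhd u; have [Nn nu] := StP _ _ Stn.
have uw' : adj u (n w) by rewrite -{1}nu adjN.
have neq_w : w != n w by rewrite eq_sym.
have nbhd_u v : adj u v -> v \in nbhd u by rewrite nbhdE.
have [z []] := card3_third (cubicX u) (nbhd_u _ uw) (nbhd_u _ uw') neq_w.
rewrite nbhdE => uz zw zw' zP.
have zP' v : adj u v -> [|| v == z, v == w | v == n w].
  move=> uv; have [//|vw] := eqVneq v w; first by rewrite !orbT.
  have [|vw'] := eqVneq v (n w); first by rewrite !orbT.
  by rewrite (zP v) ?nbhdE ?eqxx.
have Ozw : z \notin O w.
  apply/negP=> Oz; have [v [v' [uv uv' /negP[]]]] := nbhd_orbits u.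
  have Ow x : adj u x -> x \in O w.
    by move/zP'/or3P=> [] /eqP->; rewrite ?O_refl ?O_N.
  by apply: O_trans (Ow _ uv') _; rewrite O_sym Ow.
exists z, w, (n w), n; split; split=> //.
  apply/subsetP=> m /StP[Nm mu]; apply/StP; split=> //.
  have : adj u (m z) by rewrite -{1}mu adjN.
  have mzw x : x \in O w -> m z != x.
    by apply: contraTneq => <-; apply: contra Ozw; apply: O_trans; rewrite O_sym O_N.
  by case/zP'/or3P=> /eqP // mz; have := mzw (m z);
    rewrite eqxx mz ?O_refl ?O_N // => /(_ isT).
by move=> v /zP' /or3P[-> | -> | ->] //; rewrite orbT.
Qed.

(** * The matching [s] and the remaining edges *)

Let s (u : X) := odflt u [pick z | adj u z && (St u \subset St z)].

Let sP (u : X) : adj u (s u) /\ St u \subset St (s u).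
Proof.
rewrite /s; case: pickP => [z /andP[] // | no_z].
have [z [_ [_ [_ [[uz Stz _ _ _] _]]]]] := local_structure u.
by have := no_z z; rewrite uz Stz.
Qed.

Let adj_s (u : X) : adj u (s u). Proof. by case: (sP u). Qed.
Let St_s u : St u = St (s u). Proof. by apply: St_eq; case: (sP u). Qed.

(** The element taking [w] to [w'] moves both of them. This uniqueness is what makes [s] commute
    with [A] and be an involution. *)
Let s_uniq (u v : X) : adj u v -> St u \subset St v -> v = s u.
Proof.
have [z [w [w' [n [[uz Stz Stn nw neq_w] [uw uw' zw zw' zP]]]]]] := local_structure u.
have fixz x : adj u x -> St u \subset St x -> x = z.
  move=> ux /subsetP/(_ n Stn)/StP[_ nx].
  apply/eqP; apply: contraT => /(zP _ ux)/orP[] /eqP eqx; rewrite eqx in nx.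
    by rewrite nw in nx; rewrite nx eqxx in neq_w.
  by rewrite -{2}nw in nx; rewrite (perm_inj nx) eqxx in neq_w.
by move=> uv Stv; rewrite (fixz v) // -(fixz (s u)) //; case: (sP u).
Qed.

Let s_A u a : a \in A -> s (a u) = a (s u).
Proof.
by move=> Aa; apply/esym/s_uniq; [rewrite adjA | apply: St_A; case: (sP u)].
Qed.

Let sK : involutive s.
Proof. by move=> u; apply/esym/s_uniq; rewrite 1?adj_sym // -St_s. Qed.

(** Removing the perfect matching given by [s] leaves a 2-regular graph. *)
Let C u v := adj u v && (v != s u).

Let C_A u v a : a \in A -> C (a u) (a v) = C u v.
Proof. by move=> Aa; rewrite /C s_A // adjA // (inj_eq perm_inj). Qed.

Let C_sym u v : C u v = C v u.
Proof. by rewrite /C adj_sym -(inj_eq (can_inj sK)) sK eq_sym. Qed.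

Let C_structure (u : X) : exists (w w' : X) (n : {perm X}),
  [/\ n \in St u, n w = w', w != w' &
  forall v, C u v = (v == w) || (v == w')].
Proof.
have [z [w [w' [n [[uz Stz Stn nw neq_w] [uw uw' zw zw' zP]]]]]] := local_structure u.
exists w, w', n; split=> // v; rewrite /C -(s_uniq uz Stz).
apply/andP/orP => [[uv vz] | [] /eqP->]; last by rewrite eq_sym.
  by apply/orP/zP.
by rewrite eq_sym.
Qed.

(** The two [C]-neighbours of a vertex lie in one [N]-orbit, so [C]-edges join each orbit to a
    single orbit. *)
Let C_O u w x y : C u w -> x \in O u -> C x y -> y \in O w.
Proof.
have [w1 [w2 [n [/StP[Nn _] nw _ CuE]]]] := C_structure u.
have CuO v : C u v -> v \in O w1.
  by rewrite CuE => /orP[] /eqP->; rewrite ?O_refl // -nw O_N.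
move=> uw /perm_orbitP[m Nm ->]; rewrite -{1}(permKV m y) C_A ?(subsetP sNA) //.
move=> /CuO Oy; apply: O_trans (_ : y \in O (m^-1 y)) _.
  by rewrite -{1}(permKV m y) O_N.
by apply: O_trans Oy _; rewrite O_sym CuO.
Qed.

Let s_O u x : x \in O u -> s x \in O (s u).
Proof. by case/perm_orbitP=> n Nn ->; rewrite s_A ?(subsetP sNA) // O_N. Qed.

(** Otherwise, by transitivity, [s] preserves every orbit, and the orbits of [u] and of a
    [C]-neighbour cover [X]. *)
Let s_notin_O u : s u \notin O u.
Proof.
apply/negP=> Osu.
have Os x : s x \in O x by have [a Aa ->] := transA u x; rewrite s_A ?O_A.
have [w [w' [n [_ _ _ CuE]]]] := C_structure u.
have uw : C u w by rewrite CuE eqxx.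
have cl a b x y : C a b -> x \in O a -> adj x y -> y \in O a :|: O b.
  move=> ab Ox xy; rewrite inE; have [->|ys] := eqVneq y (s x).
    by rewrite (O_trans (Os x) Ox).
  by rewrite (C_O ab Ox) ?orbT // /C xy.
apply: (@not_covered u w) => x y /setUP[] Ox; first exact: cl uw Ox.
by rewrite setUC; apply: cl Ox; rewrite C_sym.
Qed.

(* O u :|: O (s u) is an orbit of <N, s>, which A normalises. *)
Lemma dvdn_double_orbit (u : X) : 2 * #|orbit 'P N u| %| #|X|.
Proof.
rewrite -/(O u); pose sp := perm (can_inj sK); pose H := (N <*> <[sp]>)%G.
have nHA : A \subset 'N(H).
  rewrite normsY ?(normal_norm nsNA) // cents_norm // cent_cycle.
  apply/subsetP=> a Aa; apply/cent1P/permP=> x.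
  by rewrite !permM !permE s_A.
have -> : (2 * #|O u|)%N = #|orbit 'P H u|; last exact: dvdn_orbit_norm_trans trA nHA.
have -> : orbit 'P H u = O u :|: O (s u).
  apply/eqP; rewrite eqEsubset acts_sub_orbit ?inE ?O_refl //=.
    apply/subsetP=> x Ox; have HN n : n \in N -> n \in H.
      by move=> Nn; apply: (subsetP (joing_subl N <[sp]>)).
    have Hs : sp \in H by rewrite (subsetP (joing_subr N <[sp]>)) ?cycle_id.
    case/setUP: Ox => /perm_orbitP[n Nn ->]; apply/perm_orbitP.
      by exists n; rewrite ?HN.
    by exists (sp * n)%g; [apply: groupM; [exact: Hs | exact: HN] | rewrite permM permE].
  rewrite join_subG cycle_subG; apply/andP; split.
    apply/subsetP=> n Nn; rewrite !inE; apply/subsetP=> x; rewrite !inE /=.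
    by case/orP=> /(O_trans (O_N x Nn)); rewrite /aperm => ->; rewrite ?orbT.
  rewrite !inE; apply/subsetP=> x; rewrite !inE /= /aperm permE.
  by case/orP=> /s_O; rewrite ?sK => ->; rewrite ?orbT.
rewrite cardsU (card_O (s u) u); suff -> : O u :&: O (s u) = set0 by rewrite cards0; lia.
apply/setP=> x; rewrite !inE; apply/negP=> /andP[Oxu Oxs].
by case/negP: (s_notin_O u); apply: O_trans Oxu; rewrite O_sym.
Qed.

(** Being fixed pointwise spreads to adjacent orbits: along [s] because [n] commutes with it, along
    [C] because a vertex is determined by its [C]-neighbours. *)
Let faithful_O u n :
    (forall x y, (forall z, C x z = C y z) -> x = y) ->
  n \in N -> {in O u, forall x, n x = x} -> n = 1.
Proof.
move=> C_inj Nn nOu; apply/permP=> x; rewrite perm1.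
pose Q x := {in O x, forall y, n y = y}.
apply: (connected_ind (Q := Q) (x := u) connX nOu) => {x} // x y xy nOx z Oz.
have [y_s | y_s] := eqVneq y (s x).
  apply: (can_inj sK); rewrite s_A ?(subsetP sNA) //.
  by rewrite nOx // -[x]sK -y_s s_O.
have Cyx : C y x by rewrite C_sym /C xy.
apply: C_inj => v; have [w [w' [m [_ _ _ CzE]]]] := C_structure z.
have nC t : C z t -> n t = t by move/(C_O Cyx Oz)/nOx.
have [nw nw'] : n w = w /\ n w' = w' by rewrite !nC ?CzE ?eqxx ?orbT.
by rewrite -(permKV n v) C_A ?(subsetP sNA) // !CzE -{2}nw -{2}nw' !(inj_eq perm_inj).
Qed.

Let card_N_fact u :
    (forall x y, (forall z, C x z = C y z) -> x = y) ->
  #|N| %| (#|O u|)`!.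
Proof.
move=> C_inj.
have actsN : N \subset 'N(O u | 'P).
  apply/subsetP=> n Nn; rewrite !inE; apply/subsetP=> x; rewrite !inE.
  by apply: O_trans; apply: O_N.
have injr : 'injm (restrm actsN (restr_perm (O u))).
  rewrite ker_restrm ker_restr_perm; apply/subsetP=> n /setIP[Nn /astabP nO].
  by apply/set1P; apply: (faithful_O (u := u)).
have <- : #|restrm actsN (restr_perm (O u)) @* N| = #|N| by rewrite card_injm.
have <- : #|perm.Sym_group (O u)| = (#|O u|)`!.
  by rewrite -card_perm; apply: eq_card => a; rewrite inE.
apply: cardSg; apply/subsetP=> _ /morphimP[n _ Nn ->]; rewrite inE.
exact: restr_perm_on.
Qed.

(** * Twins: distinct vertices with the same [C]-neighbours *)

Section Twins.

Variables v0 v1 : X.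
Hypotheses (neq_v : v1 != v0) (eqC_v : forall z, C v0 z = C v1 z).
Hypothesis O_dvd6 : forall u, #|O u| %| 6.

(** Transitivity carries the pair [v0], [v1] to every vertex, so the default is never taken. *)
Let t (u : X) := odflt u [pick v | (v != u) && [forall z, C u z == C v z]].

Let tP u : t u != u /\ forall z, C (t u) z = C u z.
Proof.
rewrite /t; case: pickP => [v /andP[vu /forallP Cv] | no_v].
  by split=> // z; apply/esym/eqP.
have [a Aa def_u] := transA v0 u; have := no_v (a v1).
rewrite def_u (inj_eq perm_inj) neq_v /= => /negbT/forallPn[z /eqP[]].
by rewrite -(permKV a z) !C_A.
Qed.

Let t_neq u : t u != u. Proof. by case: (tP u). Qed.
Let C_tl u z : C (t u) z = C u z. Proof. by case: (tP u). Qed.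
Let C_tr u z : C u (t z) = C u z. Proof. by rewrite C_sym C_tl C_sym. Qed.

Let C_twins w u v : C w u -> C w v = (v == u) || (v == t u).
Proof.
move=> wu; have := wu; rewrite -C_tr; move: wu (t_neq u).
have [a [b [n [_ _ _ CE]]]] := C_structure w; rewrite !CE.
by case/orP=> /eqP-> ne /orP[] /eqP def_t; rewrite def_t ?eqxx // in ne *; rewrite orbC.
Qed.

Let C_ex u : exists w, C u w.
Proof. by have [w [w' [n [_ _ _ CE]]]] := C_structure u; exists w; rewrite CE eqxx. Qed.

Let t_uniq u v : v != u -> (forall z, C v z = C u z) -> v = t u.
Proof.
move=> /negPf vu Cvu; have [w uw] := C_ex u.
have wv : C w v by rewrite C_sym Cvu.
by move: wv; rewrite (C_twins v (u := u)) 1?C_sym // vu => /eqP.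
Qed.

Let t_A u a : a \in A -> t (a u) = a (t u).
Proof.
move=> Aa; apply/esym/t_uniq => [|z]; first by rewrite (inj_eq perm_inj).
by rewrite -(permKV a z) !C_A.
Qed.

Let tK : involutive t.
Proof. by move=> u; apply/esym/t_uniq => [|z]; rewrite 1?eq_sym ?C_tl. Qed.

Let t_O u x : x \in O u -> t x \in O u.
Proof.
move=> Ox; apply: O_trans Ox; have [w xw] := C_ex x.
by apply: (C_O (u := w) (x := w)); rewrite ?C_tr // C_sym.
Qed.

(** The conjugate of [t] by [s], equal to [t] exactly when [s] and [t] commute. *)
Let r (u : X) := s (t (s u)).

Let r_A u a : a \in A -> r (a u) = a (r u).
Proof. by move=> Aa; rewrite /r s_A ?t_A ?s_A. Qed.

Let rK : involutive r. Proof. by move=> u; rewrite /r sK tK sK. Qed.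

Let r_O u x : x \in O u -> r x \in O u.
Proof. by move=> /s_O/t_O/s_O; rewrite sK. Qed.

Let r_neq u : r u != u.
Proof. by rewrite -[X in _ != X]sK (inj_eq (can_inj sK)) t_neq. Qed.

Let eq_A (f g : X -> X) u v :
    (forall x a, a \in A -> f (a x) = a (f x)) ->
    (forall x a, a \in A -> g (a x) = a (g x)) ->
  f u = g u -> f v = g v.
Proof. by move=> fA gA eq_fg; have [a Aa ->] := transA u v; rewrite fA ?gA ?eq_fg. Qed.

(* Otherwise <r, t> is a Klein four-group with regular orbits on O u, although
   #|O u| divides 6. *)
Let rt_neq_tr u : r u != t u -> r (t u) != t (r u).
Proof.
move=> rt_u; apply/negP=> /eqP rt_tr.
have rtC x : r (t x) = t (r x).
  apply: (eq_A (f := r \o t) (g := t \o r)) rt_tr => y a Aa /=.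
    by rewrite t_A ?r_A.
  by rewrite r_A ?t_A.
have r_neq_t x : r x != t x.
  by apply: contra rt_u => /eqP rtx; apply/eqP/(eq_A (u := x)) => // *; rewrite ?r_A ?t_A.
pose rp := perm (can_inj rK); pose tp := perm (can_inj tK).
pose W := (<[rp]> <*> <[tp]>)%G.
have Wr : rp \in W by rewrite (subsetP (joing_subl _ _)) ?cycle_id.
have Wt : tp \in W by rewrite (subsetP (joing_subr _ _)) ?cycle_id.
have orbW x : orbit 'P W x = [set x; t x; r x; t (r x)].
  apply/eqP; rewrite eqEsubset acts_sub_orbit ?inE ?eqxx //=; last first.
    rewrite join_subG !cycle_subG; apply/andP; split; rewrite !inE; apply/subsetP=> y.
      rewrite !inE /= /aperm permE -!orbA.
      by case/or4P=> /eqP->; rewrite ?rtC ?rK eqxx ?orbT.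
    by rewrite !inE /= /aperm permE -!orbA => /or4P[] /eqP->; rewrite ?tK eqxx ?orbT.
  apply/subsetP=> y; rewrite !inE -!orbA => /or4P[] /eqP->.
  - exact: orbit_refl.
  - by apply/perm_orbitP; exists tp; rewrite ?permE.
  - by apply/perm_orbitP; exists rp; rewrite ?permE.
  by apply/perm_orbitP; exists (rp * tp)%g; [apply: groupM | rewrite permM !permE].
have : 4 %| #|O u|.
  apply: (dvdn_uniform_orbits (to := 'P%act) (G := W)) => [|x _].
    rewrite join_subG !cycle_subG; apply/andP; split; rewrite !inE; apply/subsetP=> y.
      by move=> Oy; rewrite inE /= /aperm permE; apply: r_O.
    by move=> Oy; rewrite inE /= /aperm permE; apply: t_O.
  rewrite orbW -[RHS]/(size [:: x; t x; r x; t (r x)]) -(card_uniqP _).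
    by apply: eq_card => y; rewrite !inE -!orbA.
  rewrite /= !inE !negb_or ![x == _]eq_sym t_neq r_neq ![t x == _]eq_sym r_neq_t.
  rewrite (inj_eq (can_inj tK)) r_neq ![r x == _]eq_sym t_neq !andbT /=.
  by rewrite -[X in _ != X]tK (inj_eq (can_inj tK)) r_neq_t.
by move=> /dvdn_trans/(_ (O_dvd6 u)).
Qed.

(* If not, u, t u, r u, t (r u), r (t u) fill all but at most one point of O u,
   so N_u fixes O u pointwise; an element of N_u swapping w and t w then fixes or
   moves to its twin each point of O w, which r w contradicts. *)
Let st_comm u : s (t u) = t (s u).
Proof.
have [rt_u | rt_u] := eqVneq (r u) (t u); first by rewrite -rt_u /r sK.
have r_neq_t x : r x != t x.
  by apply: contra rt_u => /eqP rtx; apply/eqP/(eq_A (u := x)) => // *; rewrite ?r_A ?t_A.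
pose five := [:: u; t u; r u; t (r u); r (t u)].
have tr_neq : t (r u) != u by rewrite -{2}(tK u) (inj_eq (can_inj tK)) r_neq_t.
have rt_neq : r (t u) != u.
  by rewrite -{2}(rK u) (inj_eq (can_inj rK)) eq_sym r_neq_t.
have uniq5 : uniq five.
  rewrite /= !inE !negb_or ![u == _]eq_sym t_neq r_neq ![t u == _]eq_sym r_neq_t.
  rewrite (inj_eq (can_inj tK)) r_neq r_neq ![r u == _]eq_sym t_neq.
  rewrite (inj_eq (can_inj rK)) t_neq eq_sym [t (r u) == _]eq_sym rt_neq_tr //.
  by rewrite [u == _]eq_sym tr_neq rt_neq.
have five_O x : x \in five -> x \in O u.
  by rewrite !inE => /or4P[| | |/orP[]] /eqP->; rewrite ?(t_O, r_O) ?O_refl.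
have fixO n x : n \in St u -> x \in O u -> n x = x.
  move=> /StP[Nn nu] Ox; have An := subsetP sNA n Nn.
  have fix5 y : y \in five -> n y = y.
    by rewrite !inE => /or4P[| | |/orP[]] /eqP->; rewrite -?(t_A, r_A) ?nu.
  have [x5 | x'5] := boolP (x \in five); first exact: fix5.
  have leD : #|O u :\: [set y in five]| <= 1.
    have sub5 : [set y in five] \subset O u.
      by apply/subsetP=> y; rewrite inE; apply: five_O.
    rewrite cardsD (setIidPr sub5) cardsE (card_uniqP uniq5).
    by have := dvdn_leq _ (O_dvd6 u); rewrite leq_subLR => ->.
  have mem_D y : y \notin five -> y \in O u -> y \in O u :\: [set y in five].
    by move=> y'5 Oy; rewrite in_setD inE y'5 Oy.
  apply: (card_le1_eqP leD); apply: mem_D => //; last exact: O_trans (O_N x Nn) Ox.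
  by apply: contra x'5 => nx5; rewrite -(perm_inj (fix5 _ nx5)).
have [w [w' [n [Stn nw neq_w CuE]]]] := C_structure u; have [Nn nu] := StP _ _ Stn.
have An := subsetP sNA n Nn.
have uw : C u w by rewrite CuE eqxx.
have n_tw : n w = t w.
  have := C_twins w' uw; rewrite CuE eqxx orbT nw => /esym/orP[] /eqP // ww'.
  by rewrite ww' eqxx in neq_w.
(* Since [n] fixes [m u], it permutes the [C]-neighbours of [m u], which are [m w] and its twin. *)
have n_Ow x : x \in O w -> (n x == x) || (n x == t x).
  case/perm_orbitP=> m Nm ->; have Am := subsetP sNA m Nm.
  have Cx : C (m u) (m w) by rewrite C_A.
  by rewrite -(C_twins _ Cx) -{1}(fixO n (m u)) ?O_N // C_A.
(* Here [n] sends [r w] to [r (t w)], which is neither [r w] nor [t (r w)]. *)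
have := n_Ow _ (r_O (O_refl w)); rewrite -r_A // n_tw.
rewrite (inj_eq (can_inj rK)) (negPf (t_neq w)).
by rewrite (negPf (rt_neq_tr (r_neq_t w))).
Qed.

Lemma twins_isomorphic_Xn2 (n : nat) : #|X| = (4 * n)%N -> isomorphic X (Xn2 n).
Proof.
apply: (split_cycle_isomorphic_Xn2 sK tK st_comm adj_s t_neq) => // u.
  by apply: contra (s_notin_O u) => /eqP->; rewrite t_O.
by have [w uw] := C_ex u; exists w => v; apply: C_twins.
Qed.

End Twins.

Lemma card_normal_or_isomorphic_Xn2 (n : nat) :
    (forall u, #|orbit 'P N u| %| 6) -> #|X| = (4 * n)%N ->
  #|N| %| 720 \/ isomorphic X (Xn2 n).
Proof.
move=> O_dvd6 cardX.
have [/existsP[x /existsP[y /andP[yx /forallP Cxy]]] | no_twins] :=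
    boolP [exists x, exists y, (y != x) && [forall z, C x z == C y z]].
  by right; apply: (twins_isomorphic_Xn2 yx) => // z; apply/eqP.
left; have /dvdn_trans : #|N| %| (#|O u0|)`!.
  apply: card_N_fact => x y Cxy; apply/eqP; rewrite eq_sym.
  apply: contraR no_twins => yx; apply/existsP; exists x; apply/existsP; exists y.
  by rewrite yx; apply/forallP=> z; apply/eqP.
(* The orbit has at most six points, and k! divides 6! = 720 for k up to 6. *)
apply; have := dvdn_leq (isT : 0 < 6) (O_dvd6 u0); rewrite -/(O u0).
by move: #|O u0| => [|[|[|[|[|[|[|]]]]]]].
Qed.

End NormalSubgroup.

(** * Orders of normal [p']-subgroups and of Sylow subgroups *)

Lemma card_normal_p'subgroup (X : sgraph) (p : nat) (N : {group {perm X}}) :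
    connected X -> cubic X -> vertex_transitive X ->
    prime p -> 7 < p -> #|X| = (12 * p)%N -> N <| graph_aut X -> p^'.-group N ->
  #|N| %| 720 \/ isomorphic X (Xn2 (3 * p)).
Proof.
move=> connX cubicX trA p_pr p_gt7 cardX nsNA p'N.
have co_orb u : coprime #|orbit 'P N u| p.
  rewrite coprime_sym prime_coprime // -p'natE //.
  exact: pnat_dvd (dvdn_orbit _ _ _) p'N.
have orb12 u : #|orbit 'P N u| %| 12.
  rewrite -(Gauss_dvdl _ (co_orb u)) -cardX.
  exact: dvdn_orbit_norm_trans trA (normal_norm nsNA).
have [/existsP[u /existsP[n /and3P[Nn /eqP nu ntn]]] | free] :=
    boolP [exists u, exists n, [&& n \in N, n u == u & n != 1%g]].
  (* Two orbits have at most 24 points, fewer than 12p. *)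
  have orb_small v : 2 * #|orbit 'P N v| < #|X|.
    by have := dvdn_leq (isT : 0 < 12) (orb12 v); lia.
  have key := card_normal_or_isomorphic_Xn2 connX cubicX trA nsNA Nn nu ntn.
  apply: (key orb_small) => [v|].
    have := dvdn_double_orbit connX cubicX trA nsNA Nn nu ntn orb_small v.
    rewrite cardX (_ : 12 * p = 2 * (6 * p))%N; last by lia.
    by rewrite dvdn_pmul2l // Gauss_dvdl.
  by rewrite cardX; lia.
left; have /card_gt0P[u _] : 0 < #|X| by lia.
have <- : #|orbit 'P N u| = #|N|; last exact: dvdn_trans (orb12 u) _.
rewrite -[RHS](card_orbit_stab 'P N u) (_ : 'C_N[u | 'P] = 1%g) ?cards1 ?muln1 //.
apply/trivgP/subsetP=> n /setIP[Nn /astab1P nu]; apply/set1P/eqP.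
apply: contraR free => ntn; apply/existsP; exists u; apply/existsP; exists n.
by rewrite Nn ntn andbT; apply/eqP.
Qed.

(** Among the three neighbours of a fixed vertex the number of fixed ones is 3 mod [p]; as [p]
    exceeds 3, all are fixed, and connectedness spreads this. *)
Lemma pgroup_fixing_vertex (X : sgraph) (p : nat) (H : {group {perm X}}) (u : X) :
    connected X -> cubic X -> prime p -> 3 < p -> p.-group H ->
    H \subset graph_aut X -> H \subset 'C[u | 'P] ->
  H :=: 1%g.
Proof.
move=> connX cubicX p_pr p_gt3 pH sHA fix_u; apply/trivgP/subsetP=> h Hh.
suff fixX x : H \subset 'C[x | 'P].
  by apply/set1P/permP=> x; rewrite perm1; apply: (astab1P (subsetP (fixX x) h Hh)).
apply: (connected_ind (Q := fun x => H \subset 'C[x | 'P]) connX fix_u) => y z yz fix_y.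
have actsH : [acts H, on nbhd y | 'P].
  apply/subsetP=> k Hk; rewrite !inE; apply/subsetP=> v; rewrite !inE /= /aperm.
  have ky : k y = y by exact: (astab1P (subsetP fix_y k Hk)).
  by rewrite -{2}ky; move/graph_autP: (subsetP sHA k Hk) => ->.
have := pgroup_fix_mod pH actsH; rewrite cubicX.
have leF : #|'Fix_(nbhd y | 'P)(H)%g| <= 3.
  by rewrite -(cubicX y) subset_leq_card ?subsetIl.
rewrite !modn_small ?(leq_ltn_trans leF) // => card_fix.
have fixE : 'Fix_(nbhd y | 'P)(H)%g = nbhd y.
  by apply/eqP; rewrite eqEcard subsetIl cubicX -card_fix.
have /setIP[_ /afixP fix_z] : z \in 'Fix_(nbhd y | 'P)(H)%g by rewrite fixE inE.
by apply/subsetP=> k Hk; apply/astab1P; exact: fix_z.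
Qed.

(** The group order is [#|X|] times that of a vertex stabiliser, whose Sylow [p]-subgroups are
    trivial. *)
Lemma card_Sylow_graph_aut (X : sgraph) (p : nat) (P : {group {perm X}}) :
    connected X -> cubic X -> vertex_transitive X ->
    prime p -> 3 < p -> 0 < #|X| -> p.-Sylow(graph_aut X)%g P ->
  #|P| = partn #|X| p.
Proof.
move=> connX cubicX trA p_pr p_gt3 X_gt0 sylP; rewrite (card_Hall sylP).
have /card_gt0P[u _] := X_gt0.
have <- : #|orbit 'P (graph_aut X) u| = #|X|.
  by rewrite (atransP trA) ?inE // cardsT.
rewrite -(card_orbit_stab 'P (graph_aut_group X) u) partnM ?cardG_gt0 //; last first.
  by apply/card_gt0P; exists u; apply: orbit_refl.
have [Q sylQ] := Sylow_exists p ('C_(graph_aut_group X)[u | 'P])%G.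
rewrite -(card_Hall sylQ) (_ : gval Q = 1%g) ?cards1 ?muln1 //.
have := pHall_sub sylQ; rewrite subsetI => /andP[sQA sQu].
exact: pgroup_fixing_vertex connX cubicX p_pr p_gt3 (pHall_pgroup sylQ) sQA sQu.
Qed.

Local Close Scope group_scope.

Theorem theorem4p2 (p : nat) (p_prime : prime p) (p_gt7 : 7 < p)
    (X : sgraph) (X_connected : connected X) (X_cubic : cubic X)
    (X_vtrans : vertex_transitive X) (X_order : #|X| = 12 * p)
    (AutX_solvable : solvable (graph_aut X)) :
  (exists2 P : {group {perm X}},
     P \in 'Syl_p(graph_aut X)%g & (P <| graph_aut X)%g)
  \/ isomorphic X (Xn2 (3 * p)).
Proof.
have [P sylP] := Sylow_exists p (graph_aut_group X).
have oP : #|P| = p.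
  have := card_Sylow_graph_aut X_connected X_cubic X_vtrans p_prime _ _ sylP.
  rewrite X_order => ->; try lia.
  rewrite partnM ?(prime_gt0 p_prime) // (part_pnat_id (pnat_id p_prime)).
  rewrite part_p'nat ?mul1n // p'natE //; apply: contraL p_gt7 => p12.
  have : p \in primes 12 by rewrite mem_primes p_prime.
  by rewrite (_ : primes 12 = [:: 2; 3]) // !inE => /orP[]/eqP->.
have [N defN] : {N : {group {perm X}} | N :=: 'O_p^'(graph_aut X)%g}.
  by exists 'O_p^'(graph_aut_group X)%G.
have nsNA : (N <| graph_aut X)%g by rewrite defN pcore_normal.
have p'N : (p^'.-group N)%g by rewrite defN pcore_pgroup.
have [N720 | isoX] := card_normal_p'subgroup X_connected X_cubic X_vtrans
  p_prime p_gt7 X_order nsNA p'N; last by right.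
left; exists P; first by rewrite inE.
apply: (Sylow_normal_of_cent_pcore p_prime AutX_solvable sylP oP).
rewrite -defN; apply: pgroup_cent_dvdn720 p_prime p_gt7 (pHall_pgroup sylP) _ N720.
exact: subset_trans (pHall_sub sylP) (normal_norm nsNA).
Qed.
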